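(* Let $M=(M_j)_{j\in\mathbb{N}}\in\mathbb{R}_{>0}^{\mathbb{N}}$ and let $\Phi=(\Phi_j)_{j\in\mathbb{N}}\in\mathbb{R}_{\ge 0}^{\mathbb{N}}$ be an exponent sequence, i.e. $\liminf_{j\to\infty}\Phi_j/j>0$. Let $\mathcal{M}_{M,\Phi}:=\{M^{(c,\Phi)}: c>0\}$ with $M^{(c,\Phi)}_j:=c^{\Phi_j}M_j$. Then for every $d\ge 1$ and every non-empty open $U\subseteq\mathbb{R}^d$ one has, as locally convex vector spaces, $$\mathcal{E}_{\{M,\Phi\}}(U)=\mathcal{E}_{\{\mathcal{M}_{M,\Phi}\}}(U),\qquad \mathcal{E}_{(M,\Phi)}(U)=\mathcal{E}_{(\mathcal{M}_{M,\Phi})}(U).$$ The same two equalities hold when the symbol $\mathcal{E}$ is replaced by $\mathcal{B}$ (global classes), $\mathcal{D}$ (test function classes), $\mathcal{A}$ (ultraholomorphic classes) or $\Lambda$ (weighted spaces of complex sequences).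
   Context: $\mathbb{N}=\{0,1,2,\dots\}$. $\mathcal{E}(U)$ is the space of smooth (complex-valued) functions on $U$; for a sufficiently regular compact set $K\subset\mathbb{R}^d$ (e.g. smooth boundary and $\overline{K^\circ}=K$), $\mathcal{E}(K)$ is the space of smooth functions on $K$. $K\subset\subset U$ means that $K$ is a compact subset of $U$. For $h>0$ put $\|f\|_{M,\Phi,K,h}:=\sup_{\alpha\in\mathbb{N}^d,x\in K}\frac{|f^{(\alpha)}(x)|}{h^{\Phi_{|\alpha|}}M_{|\alpha|}}$ and let $\mathcal{E}_{M,\Phi,h}(K):=\{f\in\mathcal{E}(K):\|f\|_{M,\Phi,K,h}<\infty\}$, a Banach space. Define $$\mathcal{E}_{\{M,\Phi\}}(U)=\varprojlim_{K\subset\subset U}\varinjlim_{h>0}\mathcal{E}_{M,\Phi,h}(K)\ \text{(Roumieu)},\qquad \mathcal{E}_{(M,\Phi)}(U)=\varprojlim_{K\subset\subset U}\varprojlim_{h>0}\mathcal{E}_{M,\Phi,h}(K)\ \text{(Beurling)}.$$ For $\Phi_j=j$ write $\mathcal{E}_{M,h}(K)$. A weight matrix is a family $\mathcal{M}=\{M^{(x)}\in\mathbb{R}_{>0}^{\mathbb{N}}:x>0\}$ with $M^{(x)}_j\le M^{(y)}_j$ for all $j$ whenever $x\le y$. Its classes are $$\mathcal{E}_{\{\mathcal{M}\}}(U)=\varprojlim_{K\subset\subset U}\varinjlim_{x>0}\varinjlim_{h>0}\mathcal{E}_{M^{(x)},h}(K),\qquad \mathcal{E}_{(\mathcal{M})}(U)=\varprojlim_{K\subset\subset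 U}\varprojlim_{x>0}\varprojlim_{h>0}\mathcal{E}_{M^{(x)},h}(K).$$ Other classes: for a positive sequence $w$ consider the Banach spaces $\mathcal{B}_w(U)=\{f\in\mathcal{E}(U):\sup_{\alpha,x\in U}|f^{(\alpha)}(x)|/w_{|\alpha|}<\infty\}$; $\mathcal{D}_w(K)=\{f\in\mathcal{E}(\mathbb{R}^d):\operatorname{supp}f\subseteq K,\ \sup_{\alpha,x}|f^{(\alpha)}(x)|/w_{|\alpha|}<\infty\}$; $\mathcal{A}_w(S)=\{f \text{ holomorphic on } S:\sup_{j,z\in S}|f^{(j)}(z)|/w_j<\infty\}$ for a sector $S$ of the Riemann surface of the logarithm; $\Lambda_w=\{(a_\alpha)_{\alpha\in\mathbb{N}^d}\in\mathbb{C}^{\mathbb{N}^d}:\sup_\alpha|a_\alpha|/w_{|\alpha|}<\infty\}$. The $\{M,\Phi\}$- and $(M,\Phi)$-classes are the inductive, respectively projective, limit over $h>0$ with $w_j=h^{\Phi_j}M_j$; the $\{\mathcal{M}\}$- and $(\mathcal{M})$-classes are the inductive, respectively projective, limit over $x>0$ and $h>0$ with $w_j=h^jM^{(x)}_j$. For $\mathcal{D}(U)$ one additionally takes the inductive limit over $K\subset\subset U$. *)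

(* Defs.v *)
From HB Require Import structures.
From mathcomp Require Import all_boot all_order all_algebra.
From mathcomp Require Import all_classical all_reals all_analysis.
From mathcomp Require Import complex.

Set Implicit Arguments.
Unset Strict Implicit.
Unset Printing Implicit Defensive.

Import Order.TTheory GRing.Theory Num.Theory numFieldNormedType.Exports.

Local Open Scope classical_set_scope.
Local Open Scope ring_scope.
Local Open Scope complex_scope.

(** ** The complex numbers as a real normed space

[Rcomplex R] is the library's copy of [R[i]] carrying the structure of a real
vector space and the real-valued modulus.  The instances below add the topology
of the modulus, so that real derivatives and limits of complex-valued functions
are those of the library. *)

HB.instance Definition _ (R : realType) :=
  PseudoMetric.copy (Rcomplex R) (pseudoMetric_normed (Rcomplex R)).
HB.instance Definition _ (R : realType) := isPointed.Build (Rcomplex R) 0.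
HB.instance Definition _ (R : realType) :=
  NormedZmod_PseudoMetric_eq.Build R (Rcomplex R) erefl.

Lemma Rcomplex_normrZ (R : realType) (l : R) (x : Rcomplex R) :
  `| l *: x | = `| l | * `| x |.
Proof.
case: x => a b; rewrite /Num.norm/= /GRing.scale/= !exprMn -mulrDr.
by rewrite sqrtrM ?sqr_ge0// sqrtr_sqr.
Qed.

HB.instance Definition _ (R : realType) :=
  PseudoMetricNormedZmod_Lmodule_isNormedModule.Build R (Rcomplex R)
    (@Rcomplex_normrZ R).

Definition modulus (R : realType) (z : R[i]) : R := `| (z : Rcomplex R) |.

(** ** Locally convex spaces and their limits

All spaces are subspaces of an ambient complex vector space [V] (a space of
functions), with a topology of their own.  Such a space is given by its carrier
and its open sets, so that [=] between two of them means: same vectors (hence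
the same vector space) and same topology. *)

Record subtop (V : Type) := SubTop {
  points : set V ;
  opens : set (set V)
}.

Definition is_topology (V : Type) (X : set V) (T : set (set V)) : Prop :=
  [/\ forall O, T O -> O `<=` X,
      T X,
      forall O P, T O -> T P -> T (O `&` P) &
      forall F : set (set V), F `<=` T -> T (\bigcup_(O in F) O)].

Definition cont_map (V W : Type) (f : V -> W) (X : subtop V) (Y : subtop W) :=
  (forall x, points X x -> points Y (f x)) /\
  (forall O, opens Y O -> opens X (points X `&` f @^-1` O)).

Section lcs.
Variables (R : realType) (V : lmodType R[i]).

(* Locally convex spaces are not required to be Hausdorff. *)
Record is_lcs (X : subtop V) : Prop := IsLcs {
  lcs_topology : is_topology (points X) (opens X) ;
  lcs_zero : points X 0 ;
  lcs_linear : forall (a : R[i]) x y,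
    points X x -> points X y -> points X (a *: x + y) ;
  lcs_add : forall x y O, points X x -> points X y -> opens X O -> O (x + y) ->
    exists P Q, [/\ opens X P, opens X Q, P x, Q y &
                    forall u v, P u -> Q v -> O (u + v)] ;
  lcs_scale : forall (a : R[i]) x O, points X x -> opens X O -> O (a *: x) ->
    exists e : R, exists P, [/\ 0 < e, opens X P, P x &
      forall b u, modulus (b - a) < e -> P u -> O (b *: u)] ;
  lcs_convex : forall O, opens X O -> O 0 ->
    exists P, [/\ opens X P, P 0, P `<=` O &
      forall (t : R) u v, 0 <= t <= 1 -> P u -> P v ->
        P (t%:C *: u + (1 - t)%:C *: v)]
}.

(* The space of all [f] in [A] with [N f < +oo], for [N] an (extended) norm. *)
Definition normed_space (A : set V) (N : V -> \bar R) : subtop V :=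
  let X := [set f | A f /\ (N f < +oo)%E] in
  SubTop X [set O | O `<=` X /\
    forall f, O f -> exists2 e : R, 0 < e &
      forall g, X g -> (N (g - f)%R < e%:E)%E -> O g].

(* Inductive limit of subspaces along the inclusions: the union, with the
   finest locally convex topology for which all the inclusions are continuous,
   i.e. the supremum of all such locally convex topologies. *)
Definition indlim (I : Type) (E : I -> subtop V) : subtop V :=
  let X := \bigcup_(i in setT) points (E i) in
  SubTop X [set O | forall T, is_topology X T ->
    (forall T', is_lcs (SubTop X T') ->
       (forall i, cont_map id (E i) (SubTop X T')) -> T' `<=` T) ->
    T O].

(* Projective limit of the [E i], realized as the space of those [f] in [A]
   with [r i f] in [E i] for all [i], with the coarsest topology for which all
   the maps [r i] are continuous. *)
Definition projlim (I : Type) (A : set V) (r : I -> V -> V)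
    (E : I -> subtop V) : subtop V :=
  let X := [set f | A f /\ forall i, points (E i) (r i f)] in
  SubTop X [set O | forall T, is_topology X T ->
    (forall i, cont_map (r i) (SubTop X T) (E i)) -> T O].

(* Projective limit along inclusions: the intersection. *)
Definition interlim (I : Type) (E : I -> subtop V) : subtop V :=
  projlim setT (fun=> id) E.

End lcs.

(** ** Weight sequences and weight matrices *)

Definition exponent_sequence (R : realType) (Phi : nat -> R) : Prop :=
  (forall j, 0 <= Phi j) /\
  (0 < limn_einf (fun j => (Phi j / j%:R)%:E))%E.

Record weight_matrix (R : realType) := WeightMatrix {
  wmatrix :> {posnum R} -> nat -> R ;
  wmatrix_gt0 : forall x j, 0 < wmatrix x j ;
  wmatrix_le : forall x y : {posnum R}, x%:num <= y%:num ->
    forall j, wmatrix x j <= wmatrix y j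
}.

Section exponent_matrix.
Variables (R : realType) (M Phi : nat -> R).
Hypotheses (M_gt0 : forall j, 0 < M j) (Phi_exp : exponent_sequence Phi).

Let matrix (c : {posnum R}) (j : nat) : R := c%:num `^ Phi j * M j.

Let matrix_gt0 c j : 0 < matrix c j.
Proof. by rewrite mulr_gt0// powR_gt0. Qed.

Let matrix_le (x y : {posnum R}) : x%:num <= y%:num ->
  forall j, matrix x j <= matrix y j.
Proof.
move=> xy j; rewrite ler_pM2r//.
by apply: ge0_ler_powR => //; [exact: Phi_exp.1|rewrite nnegrE..].
Qed.

Definition exponent_matrix : weight_matrix R :=
  WeightMatrix matrix_gt0 matrix_le.

End exponent_matrix.

(* The Roumieu and Beurling limits of a family [B w] of Banach spaces indexed by
   the weights [w].  For a weight matrix, the limits over [x] and [h] are either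
   taken successively ([_local]), or simultaneously. *)
Section limits_of_steps.
Variables (R : realType) (V : lmodType R[i]).

Definition roumieu_seq (M Phi : nat -> R) (B : (nat -> R) -> subtop V) :=
  indlim (fun h : {posnum R} => B (fun j => h%:num `^ Phi j * M j)).

Definition beurling_seq (M Phi : nat -> R) (B : (nat -> R) -> subtop V) :=
  interlim (fun h : {posnum R} => B (fun j => h%:num `^ Phi j * M j)).

Definition roumieu_mat_local (MM : weight_matrix R)
    (B : (nat -> R) -> subtop V) :=
  indlim (fun x : {posnum R} =>
    indlim (fun h : {posnum R} => B (fun j => h%:num ^+ j * MM x j))).

Definition beurling_mat_local (MM : weight_matrix R)
    (B : (nat -> R) -> subtop V) :=
  interlim (fun x : {posnum R} =>
    interlim (fun h : {posnum R} => B (fun j => h%:num ^+ j * MM x j))).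

Definition roumieu_mat (MM : weight_matrix R) (B : (nat -> R) -> subtop V) :=
  indlim (fun xh : {posnum R} * {posnum R} =>
    B (fun j => xh.2%:num ^+ j * MM xh.1 j)).

Definition beurling_mat (MM : weight_matrix R) (B : (nat -> R) -> subtop V) :=
  interlim (fun xh : {posnum R} * {posnum R} =>
    B (fun j => xh.2%:num ^+ j * MM xh.1 j)).

End limits_of_steps.

(** ** Smooth functions

A function on a subset [S] of [R^d] is represented by its extension by zero to
[R^d], which makes equality of functions on [S] equality of representatives. *)

Definition mdegree (d : nat) (a : {ffun 'I_d -> nat}) : nat :=
  (\sum_(i < d) a i)%N.

Section smooth.
Variables (R : realType) (d : nat) (W : normedModType R).
Implicit Types (U : set 'rV[R]_d) (f : 'rV[R]_d -> W).

Definition partial (i : 'I_d) f : 'rV[R]_d -> W :=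
  fun x => 'D_(delta_mx 0 i) f x.

Definition partials (s : seq 'I_d) f : 'rV[R]_d -> W := foldr partial f s.

(* [U] is meant to be open. *)
Definition smooth_on U f : Prop :=
  forall (s : seq 'I_d) x, U x ->
    {for x, continuous (partials s f)} /\
    forall i, derivable (partials s f) x (delta_mx 0 i).

Definition mpartial (a : {ffun 'I_d -> nat}) f : 'rV[R]_d -> W :=
  foldr (fun i => iter (a i) (partial i)) f (enum 'I_d).

End smooth.

Section function_classes.
Variables (R : realType) (d : nat).
Local Notation Rd := 'rV[R]_d.
Local Notation fct := (Rd -> R[i]).
Implicit Types (U K : set Rd) (f : fct) (w : nat -> R).

Definition smooth U f : Prop := @smooth_on R d (Rcomplex R) U f.

Definition mderiv (a : {ffun 'I_d -> nat}) f : fct :=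
  @mpartial R d (Rcomplex R) a f.

Definition smooth_functions U : set fct :=
  [set f | smooth U f /\ forall x, ~ U x -> f x = 0].

(* Near each boundary point, [K] is the sublevel set of a submersion. *)
Definition smooth_boundary K : Prop :=
  forall p, K p -> ~ K° p ->
    exists (O : set Rd) (rho : Rd -> R),
      [/\ open O /\ O p, smooth_on O rho,
          exists i, partial i rho p != 0 &
          forall x, O x -> (K x <-> rho x <= 0)].

Definition regular_compact K : Prop :=
  [/\ compact K, closure K° = K & smooth_boundary K].

(* For [closure K° = K], the smooth functions on [K] are the smooth functions
   on the interior of [K] all of whose derivatives extend continuously to [K];
   [mderiv_on K a f] is this continuous extension of the derivative. *)
Definition mderiv_on K (a : {ffun 'I_d -> nat}) f (x : Rd) : R[i] :=
  lim ((mderiv a f : Rd -> Rcomplex R) @ within K° (nbhs x)).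

Definition smooth_functions_on K : set fct :=
  [set f | [/\ smooth K° f,
      forall a x, K x ->
        cvg ((mderiv a f : Rd -> Rcomplex R) @ within K° (nbhs x)),
      forall x, K x ->
        (f : Rd -> Rcomplex R) @ within K° (nbhs x) --> (f x : Rcomplex R) &
      forall x, ~ K x -> f x = 0]].

Definition restr K f : fct := patch (fun=> 0) K f.

Definition E_step K w : subtop fct :=
  normed_space (smooth_functions_on K) (fun f =>
    ereal_sup [set (modulus (mderiv_on K p.1 f p.2) / w (mdegree p.1))%:E
              | p in [set p : {ffun 'I_d -> nat} * Rd | K p.2]]).

Definition B_step U w : subtop fct :=
  normed_space (smooth_functions U) (fun f =>
    ereal_sup [set (modulus (mderiv p.1 f p.2) / w (mdegree p.1))%:E
              | p in [set p : {ffun 'I_d -> nat} * Rd | U p.2]]).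

Definition D_step K w : subtop fct :=
  normed_space
    [set f | smooth setT f /\ closure [set x | f x != 0] `<=` K] (fun f =>
    ereal_sup [set (modulus (mderiv p.1 f p.2) / w (mdegree p.1))%:E
              | p in [set: {ffun 'I_d -> nat} * Rd]]).

(* In the classes below, [L] is one of the limits [roumieu_*], [beurling_*], such
   as [roumieu_seq M Phi]. *)

Definition E_class U (L : ((nat -> R) -> subtop fct) -> subtop fct) :=
  projlim (smooth_functions U)
    (fun k : {K : set Rd | regular_compact K /\ K `<=` U} => restr (sval k))
    (fun k => L (E_step (sval k))).

Definition B_class U (L : ((nat -> R) -> subtop fct) -> subtop fct) :=
  L (B_step U).

Definition D_class U (L : ((nat -> R) -> subtop fct) -> subtop fct) :=
  indlim (fun k : {K : set Rd | compact K /\ K `<=` U} => L (D_step (sval k))).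

Definition Lambda_step w : subtop ({ffun 'I_d -> nat} -> R[i]) :=
  normed_space setT (fun c =>
    ereal_sup [set (modulus (c a) / w (mdegree a))%:E
              | a in [set: {ffun 'I_d -> nat}]]).

Definition Lambda_class
    (L : ((nat -> R) -> subtop ({ffun 'I_d -> nat} -> R[i])) ->
         subtop ({ffun 'I_d -> nat} -> R[i])) :=
  L Lambda_step.

End function_classes.

(** ** Holomorphic functions on sectors

A point of the Riemann surface of the logarithm is the pair of its modulus
[> 0] and its argument in [R]. *)

Section ultraholomorphic.
Variable R : realType.
Local Notation fct := (R * R -> R[i]).
Implicit Types (S : set (R * R)) (f : fct) (w : nat -> R).

(* Bisecting direction [tau], opening [gamma * pi], radius [r] (maybe [+oo]). *)
Definition sector (tau gamma : R) (r : \bar R) : set (R * R) :=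
  [set p | [/\ 0 < p.1, (p.1%:E < r)%E & `|p.2 - tau| < gamma * pi / 2]].

(* The projection onto the punctured plane; a local coordinate. *)
Definition log_proj (p : R * R) : R[i] :=
  (p.1 * cos p.2) +i* (p.1 * sin p.2).

Definition diff_quotient f (p q : R * R) : Rcomplex R :=
  (f q - f p) / (log_proj q - log_proj p).

Definition cderiv f : fct := fun p => lim (diff_quotient f p @ p^').

Definition holomorphic_functions S : set fct :=
  [set f | (forall p, S p -> cvg (diff_quotient f p @ p^')) /\
           (forall p, ~ S p -> f p = 0)].

Definition A_step S w : subtop fct :=
  normed_space (holomorphic_functions S) (fun f =>
    ereal_sup [set (modulus (iter p.1 cderiv f p.2) / w p.1)%:E
              | p in [set p : nat * (R * R) | S p.2]]).

Definition A_class S (L : ((nat -> R) -> subtop fct) -> subtop fct) :=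
  L (A_step S).

End ultraholomorphic.

(* Main.v *)
(** If [Phi j >= delta j] for all large [j], then [h ^ j <= C l ^ Phi j] with
[l = max(1, h) ^ (1 / delta)], and dually for small [h]: the geometric factors
of the weight-matrix classes are absorbed, up to a constant, by a change of the
parameter of [c ^ Phi j].  Hence the step spaces of the two systems embed
continuously into each other, and inductive and projective limits depend only on
such mutually cofinal systems.  In the local Roumieu case the limits over [x]
and [h] are taken successively; merging them requires each inner limit to be a
linear space, since only then does a locally convex topology on the whole union
restrict to a locally convex topology on it. *)

Require Import Defs.
From mathcomp Require Import all_boot all_order all_algebra.
From mathcomp Require Import all_classical all_reals all_analysis.
From mathcomp Require Import complex.

Import Order.TTheory GRing.Theory Num.Theory numFieldNormedType.Exports.

Local Open Scope classical_set_scope.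
Local Open Scope ring_scope.

(** * Universal properties of inductive and projective limits *)

Lemma cont_map_id_trans {V : Type} {X Y Z : subtop V} :
  cont_map id X Y -> cont_map id Y Z -> cont_map id X Z.
Proof.
move=> [XY XYo] [YZ YZo]; split=> [x /XY /YZ //|U /YZo /XYo].
rewrite setIA (_ : points X `&` _ = points X)//.
by apply/seteqP; split=> [x []//|x Xx]; split=> //; exact: XY.
Qed.

Section limits.
Context {R : realType} {V : lmodType R[i]}.
Implicit Types (X Y : subtop V) (A : set V).

(** The topology of [indlim] is generated by the locally convex topologies on the union that make
    all inclusions continuous. It is therefore determined by the union and by the locally convex
    spaces into which all steps embed continuously. *)
Lemma eq_indlim {I J : Type} {E : I -> subtop V} {F : J -> subtop V} :
  \bigcup_(i in setT) points (E i) = \bigcup_(j in setT) points (F j) ->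
  (forall Y, is_lcs Y -> (forall i, cont_map id (E i) Y) <->
                         (forall j, cont_map id (F j) Y)) ->
  indlim E = indlim F.
Proof.
rewrite /indlim => <- EF; congr SubTop; apply: eq_set => U.
apply/propext; split=> + T topT HT; apply => // T' lcsT' contT';
  by apply: HT => //; apply/(EF _ lcsT').
Qed.

Lemma indlim_cofinal {I J : Type} {E : I -> subtop V} {F : J -> subtop V} :
  (forall i, exists j, cont_map id (E i) (F j)) ->
  (forall j, exists i, cont_map id (F j) (E i)) ->
  indlim E = indlim F.
Proof.
move=> EF FE; apply: eq_indlim => [|Y _].
  apply/seteqP; split=> x [i _ xi].
    by have [j [ij _]] := EF i; exists j => //; exact: ij.
  by have [j [ij _]] := FE i; exists j => //; exact: ij.
split=> contY i.
  by have [j ij] := FE i; exact: cont_map_id_trans ij (contY j).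
by have [j ij] := EF i; exact: cont_map_id_trans ij (contY j).
Qed.

(** Test spaces determine the carrier as well as the topology: a vector [x] lies in every step iff
    the discrete one-point space on [x] maps continuously into every step. *)
Lemma eq_interlim {I J : Type} {E : I -> subtop V} {F : J -> subtop V} :
  (forall Y, is_topology (points Y) (opens Y) ->
     (forall i, cont_map id Y (E i)) <-> (forall j, cont_map id Y (F j))) ->
  interlim E = interlim F.
Proof.
move=> EF; rewrite /interlim /projlim.
have discrete_topology (X : set V) : is_topology X [set U | U `<=` X].
  split=> // [U P UX _ x [/UX]//|G GX x [U GU Ux]]; exact: GX GU _ Ux.
have discrete_cont (K : Type) (G : K -> subtop V) (x : V) :
    (forall k, points (G k) x) <->
    (forall k, cont_map id (SubTop [set x] [set U | U `<=` [set x]]) (G k)).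
  split=> [Gx k|Gx k]; last by case: (Gx k) => + _; apply.
  by split=> [_ ->|U _ y []]//; exact: Gx.
have -> : [set f : V | setT f /\ forall i, points (E i) (id f)] =
          [set f : V | setT f /\ forall j, points (F j) (id f)].
  apply: eq_set => f; apply/propext; split=> -[_ Ef]; split=> //.
    by apply/discrete_cont/EF => //; exact/discrete_cont.
  by apply/discrete_cont/EF => //; exact/discrete_cont.
congr SubTop; apply: eq_set => U.
by apply/propext; split=> + T topT HT; apply => //; apply/(EF (SubTop _ T)).
Qed.

Lemma interlim_cofinal {I J : Type} {E : I -> subtop V} {F : J -> subtop V} :
  (forall i, exists j, cont_map id (F j) (E i)) ->
  (forall j, exists i, cont_map id (E i) (F j)) ->
  interlim E = interlim F.
Proof.
move=> EF FE; apply: eq_interlim => Y _; split=> contY i.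
  by have [j ij] := FE i; exact: cont_map_id_trans (contY j) ij.
by have [j ij] := EF i; exact: cont_map_id_trans (contY j) ij.
Qed.

Lemma cont_map_interlim {I : Type} (E : I -> subtop V) Y :
  is_topology (points Y) (opens Y) ->
  cont_map id Y (interlim E) <-> forall i, cont_map id Y (E i).
Proof.
move=> [subY YT YI YU]; split=> [[YE YEo] i|contY].
  apply: cont_map_id_trans (conj YE YEo) _.
  by split=> [x [_ Ex]|U Uo /= T _ contT]; [exact: Ex|exact: (contT i).2].
split=> [x Yx|U Uo]; first by split=> // i; exact: (contY i).1.
set X1 := points (interlim E).
have YX1 : points Y `<=` X1 by move=> x Yx; split=> // i; exact: (contY i).1.
(* The sets with open trace on [Y] form a topology on the limit that makes all projections
   continuous. The limit topology is the coarsest such, so [U] belongs to this one. *)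
suff [] : [set U | U `<=` X1 /\ opens Y (points Y `&` U)] U by [].
apply: Uo => [|i].
  split=> [U' []//||U1 U2 [U1X U1Y] [U2X U2Y]|F FX].
  - by split=> //; rewrite (_ : _ `&` X1 = points Y)//; apply: setIidl.
  - split; first by move=> x [/U1X].
    by rewrite setIIr; exact: YI.
  - split; first by move=> x [U' /FX[U'X _] /U'X].
    rewrite (_ : _ `&` _ = \bigcup_(Q in [set points Y `&` Q | Q in F]) Q).
      by apply: YU => _ [Q /FX[_ ? ]<-].
    by rewrite setI_bigcupr bigcup_image.
split=> [x [_ Ex]|U' Uo']; first exact: Ex.
split; first by move=> x [].
by rewrite setIA (_ : points Y `&` _ = points Y);
  [exact: (contY i).2|exact: setIidl].
Qed.

Lemma interlim_interlim {I J : Type} (E : I -> J -> subtop V) :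
  interlim (fun i => interlim (E i)) = interlim (fun ij => E ij.1 ij.2).
Proof.
apply: eq_interlim => Y topY; split=> contY.
  by move=> [i j]; have /cont_map_interlim := contY i; exact.
by move=> i; apply/cont_map_interlim => // j; exact: (contY (i, j)).
Qed.

Definition linear_subspace A : Prop :=
  A 0 /\ forall (a : R[i]) x y, A x -> A y -> A (a *: x + y).

(** This supplies admissible topologies on an inductive limit, as traces of locally convex
    topologies on larger spaces. *)
Lemma is_lcs_subspace X A : is_lcs X -> linear_subspace A -> A `<=` points X ->
  is_lcs (SubTop A [set A `&` U | U in opens X]).
Proof.
move=> [[subX XT XI XU] X0 Xlin Xadd Xscale Xconv] [A0 Alin] AX.
have Aadd u v : A u -> A v -> A (u + v).
  by move=> Au Av; rewrite -[u]scale1r; exact: Alin.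
have Ascale a u : A u -> A (a *: u).
  by move=> Au; rewrite -[_ *: _]addr0; exact: Alin.
split=> //=.
- split=> [U [U' _ <-] x []//||_ _ [U Uo <-] [P Po <-]|F FA].
  + by exists (points X) => //; apply: setIidl.
  + by exists (U `&` P); [exact: XI|rewrite setIIr].
  (* Taking every open [U] whose trace lies in [F] avoids choosing one [U] for each member of
     [F]. *)
  + exists (\bigcup_(U in [set U | opens X U /\ F (A `&` U)]) U).
      by apply: XU => U [].
    apply/seteqP; split=> [x [Ax [U [Uo FU] Ux]]|x [Q FQ Qx]].
      by exists (A `&` U).
    have [U Uo AU] := FA _ FQ; move: Qx FQ; rewrite -AU => -[Ax Ux] FU.
    by split=> //; exists U.
- move=> x y _ Ax Ay [U Uo <-] [_ Uxy].
  have [P [Q [Po Qo Px Qy PQ]]] := Xadd x y U (AX _ Ax) (AX _ Ay) Uo Uxy.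
  exists (A `&` P), (A `&` Q); split=> //; [by exists P|by exists Q|].
  by move=> u v [Au Pu] [Av Qv]; split; [exact: Aadd|exact: PQ].
- move=> a x _ Ax [U Uo <-] [_ Uax].
  have [e [P [e0 Po Px PU]]] := Xscale a x U (AX _ Ax) Uo Uax.
  exists e, (A `&` P); split=> //; first by exists P.
  by move=> b u be [Au Pu]; split; [exact: Ascale|exact: PU].
- move=> _ [U Uo <-] [_ U0]; have [P [Po P0 PU Pconv]] := Xconv U Uo U0.
  exists (A `&` P); split=> //; [by exists P|exact: setIS|].
  move=> t u v t01 [Au Pu] [Av Pv]; split; last exact: Pconv.
  by apply: Alin => //; exact: Ascale.
Qed.

(** Linearity of the union makes the trace of [Y] on it locally convex, so this trace is one of the
    topologies whose supremum defines [indlim E]. *)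
Lemma cont_map_indlim {I : Type} (E : I -> subtop V) Y :
  (forall i, is_topology (points (E i)) (opens (E i))) ->
  linear_subspace (points (indlim E)) -> is_lcs Y ->
  cont_map id (indlim E) Y <-> forall i, cont_map id (E i) Y.
Proof.
move=> topE linE lcsY; split=> [contY i|contY].
  apply: cont_map_id_trans contY; split=> [x Ex|U Uo]; first by exists i.
  set X := points (indlim E).
  have EX j : points (E j) `<=` X by move=> x Ex; exists j.
  (* The final topology, locally convex or not, contains every admissible locally convex topology;
     hence it contains their supremum. *)
  suff [] : [set U | U `<=` X /\ forall j, opens (E j) (points (E j) `&` U)] U.
    by move=> _; exact.
  apply: Uo => [|T' lcsT' contT' Q T'Q]; last first.
    split=> [|j]; last exact: (contT' j).2.
    by have [+ _ _ _] := lcs_topology lcsT'; exact.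
  split=> [Q []//||P Q [PX Po] [QX Qo]|F FX].
  - split=> // j; rewrite (setIidl _)//.
    by have [] := topE j.
  - split=> [x [/PX]//|j]; rewrite setIIr.
    by have [_ _ + _] := topE j; exact.
  - split=> [x [Q /FX[QX _] /QX]//|j].
    rewrite setI_bigcupr -(bigcup_image F (fun Q => points (E j) `&` Q) id).
    have [_ _ _] := topE j; apply => _ [Q /FX[_ +] <-]; exact.
have EY : points (indlim E) `<=` points Y.
  by move=> x [i _]; exact: (contY i).1.
split=> // U Uo /= T _ HT.
apply: (HT [set points (indlim E) `&` Q | Q in opens Y]); last by exists U.
  exact: is_lcs_subspace.
move=> i; split=> [x Ex|_ [Q Qo <-]]; first by exists i.
rewrite setIA (_ : _ `&` points _ = points (E i)); first exact: (contY i).2.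
by apply: setIidl => x Ex; exists i.
Qed.

Lemma indlim_indlim {I J : Type} (E : I -> J -> subtop V) :
  (forall i j, is_topology (points (E i j)) (opens (E i j))) ->
  (forall i, linear_subspace (points (indlim (E i)))) ->
  indlim (fun i => indlim (E i)) = indlim (fun ij => E ij.1 ij.2).
Proof.
move=> topE linE; apply: eq_indlim => [|Y lcsY].
  apply/seteqP; split=> x [i _].
    by move=> [j _ Ex]; exists (i, j).
  by move=> Ex; exists i.1 => //; exists i.2.
split=> contY.
  by move=> [i j]; have /cont_map_indlim := contY i; exact.
by move=> i; apply/cont_map_indlim => // j; exact: (contY (i, j)).
Qed.

End limits.

(** * Comparison of [h ^+ j] with powers of exponent [Phi j] *)

(** The lower limit is the supremum of the tail infima, so some tail infimum is positive; it serves
    as [delta]. *)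
Lemma exponent_sequence_ge {R : realType} {Phi : nat -> R} :
  exponent_sequence Phi ->
  exists2 delta : R, 0 < delta &
    exists n, forall j, (n <= j)%N -> delta * j%:R <= Phi j.
Proof.
pose u j := (Phi j / j%:R)%:E.
move=> [Phi0]; rewrite limn_einf_lim (cvg_lim _ (@cvg_einfs_sup R u))//.
move=> /ereal_sup_gt[_ [n _ <-]] einf0.
have einfsP j : (n <= j)%N ->
    (einfs u n <= u j)%E.
  by move=> nj; apply: ereal_inf_lbound; exists j.
(* The tail infimum is finite: it is at most the real number [u n], and it is positive. *)
case: einfs einf0 einfsP => [delta|/= _ /(_ n (leqnn n))//|//].
rewrite lte_fin => delta0 deltaP; exists delta => //; exists n => j nj.
(* At [j = 0] the quotient [u 0] divides by zero and carries no information; there the claim is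
   [0 <= Phi 0]. *)
case: j nj => [|j] nj; first by rewrite mulr0.
by rewrite -ler_pdivlMr// -lee_fin deltaP.
Qed.

Lemma expr_le_powR_exponent {R : realType} {Phi : nat -> R} {h : R} :
  exponent_sequence Phi -> 0 < h ->
  exists l C : {posnum R}, forall j, h ^+ j <= C%:num * l%:num `^ Phi j.
Proof.
move=> PhiE h0; have [delta delta0 [n deltaP]] := exponent_sequence_ge PhiE.
pose h1 := Num.max 1 h; have h1_ge1 : 1 <= h1 by rewrite /h1 le_max lexx.
have h1_gt0 : 0 < h1 by exact: lt_le_trans h1_ge1.
have l0 : 0 < h1 `^ delta^-1 by exact: powR_gt0.
have C0 : 0 < h1 ^+ n by exact: exprn_gt0.
exists (PosNum l0), (PosNum C0) => j /=.
have /le_trans -> // : h ^+ j <= h1 ^+ j.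
  apply: lerXn2r; rewrite ?nnegrE ?(ltW h0) ?(ltW h1_gt0)//.
  by rewrite /h1 le_max lexx orbT.
(* Since [h1 >= 1], its powers grow with the exponent. For [j >= n], [j <= Phi j / delta] and the
   constant [h1 ^+ n] is at least 1. For [j < n] that constant dominates [h1 ^+ j], and the other
   factor is at least 1 because [Phi j >= 0]. *)
rewrite -powRrM; have [nj|jn] := leqP n j.
  rewrite -[leLHS]mul1r ler_pM ?exprn_ge0 ?exprn_ege1 ?(ltW h1_gt0)//.
  by rewrite -powR_mulrn ?(ltW h1_gt0)// ler_powR// ler_pdivlMl// deltaP.
rewrite -[leLHS]mulr1 ler_pM ?exprn_ge0 ?(ltW h1_gt0)//.
  by rewrite ler_weXn2l// ltnW.
by rewrite -(powRr0 h1) ler_powR// mulr_ge0 ?invr_ge0 ?(ltW delta0)//;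
  apply PhiE.
Qed.

(** The previous bound for [h^-1], inverted: the parameter becomes [l^-1] and the constant stays the
    same. *)
Lemma powR_exponent_le_expr {R : realType} {Phi : nat -> R} {h : R} :
  exponent_sequence Phi -> 0 < h ->
  exists l C : {posnum R}, forall j, l%:num `^ Phi j <= C%:num * h ^+ j.
Proof.
move=> PhiE h0; have hV0 : 0 < h^-1 by rewrite invr_gt0.
have [l [C lC]] := expr_le_powR_exponent PhiE hV0.
exists (l%:num^-1)%:pos, C => j /=.
rewrite -powR_inv1 // -powRrM mulN1r powRN -ler_pdivrMr ?exprn_gt0//.
rewrite mulrC -exprVn ler_pdivrMr ?powR_gt0//.
Qed.

(** * Weighted sup-norm spaces: continuous inclusions and linearity *)

Section steps.
Context {R : realType} {V : lmodType R[i]}.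

Lemma normed_space_topology (A : set V) (N : V -> \bar R) :
  is_topology (points (normed_space A N)) (opens (normed_space A N)).
Proof.
split=> [U []//||U P [UX Uo] [PX Po]|F Fo].
- by split=> // f _; exists 1.
- split=> [f [/UX]//|f [/Uo[e e0 eU] /Po[e' e'0 eP]]].
  exists (Num.min e e') => [|g Xg]; first by rewrite lt_min e0.
  by rewrite EFin_min lt_min => /andP[? ?]; split; [exact: eU|exact: eP].
- split=> [f [U /Fo[UX _] /UX]//|f [U FU Uf]].
  have [_ /(_ f Uf)[e e0 eU]] := Fo _ FU.
  by exists e => // g Xg fg; exists U => //; exact: eU.
Qed.

Lemma cont_map_normed_space (A : set V) (N N' : V -> \bar R) (C : R) :
  0 < C -> (forall f, N' f <= C%:E * N f)%E ->
  cont_map id (normed_space A N) (normed_space A N').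
Proof.
move=> C0 NN'; have sub f : A f /\ (N f < +oo)%E -> A f /\ (N' f < +oo)%E.
  move=> [Af Nf]; split=> //; apply: le_lt_trans (NN' f) _.
  (* [N f] may be [-oo], as is a supremum over an empty index set; then [C * N f] is [-oo] too. *)
  by case: (N f) Nf => [r _||_]//; rewrite ?ltry// gt0_muleNy.
split=> // U [_ Uo]; split=> [f []//|f [_ /Uo[e e0 eU]]].
exists (e / C) => [|g Xg fg]; first by rewrite divr_gt0.
split=> //; apply: eU; first exact: sub.
apply: le_lt_trans (NN' _) _; rewrite -lte_pdivlMl//.
by rewrite -EFinM mulrC.
Qed.

(* Every step space of Defs is an instance, by conversion. *)
Definition weighted_space {P : Type} (A : set V) (S : set P)
    (D : V -> P -> R[i]) (deg : P -> nat) (w : nat -> R) : subtop V :=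
  normed_space A (fun f =>
    ereal_sup [set (modulus (D f p) / w (deg p))%:E | p in S]).

Lemma modulus_ge0 (z : R[i]) : 0 <= modulus z.
Proof. exact: normr_ge0. Qed.

Lemma modulusM (z z' : R[i]) : modulus (z * z') = modulus z * modulus z'.
Proof. exact: Normc.normcM. Qed.

Lemma cont_map_weighted_space {P : Type} (A : set V) (S : set P) D deg
    (w w' : nat -> R) (C : R) :
  0 < C -> (forall j, 0 < w j) -> (forall j, 0 < w' j) ->
  (forall j, w j <= C * w' j) ->
  cont_map id (weighted_space A S D deg w) (weighted_space A S D deg w').
Proof.
move=> C0 w0 w'0 ww'; apply: (@cont_map_normed_space _ _ _ C) => // f.
apply: ge_ereal_sup => _ [p Sp <-].
apply: (@le_trans _ _ (C%:E * (modulus (D f p) / w (deg p))%:E)%E).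
  rewrite -EFinM lee_fin mulrCA ler_wpM2l ?modulus_ge0//.
  by rewrite ler_pdivlMr// mulrC ler_pdivrMr.
by rewrite lee_pmul2l//; apply: ereal_sup_ubound; exists p.
Qed.

Lemma weighted_space_subspace {P : Type} (A : set V) (S : set P) D deg
    (w : nat -> R) :
  (forall j, 0 < w j) -> linear_subspace A ->
  (forall a f g p, A f -> A g -> S p -> D (a *: f + g) p = a * D f p + D g p) ->
  linear_subspace (points (weighted_space A S D deg w)).
Proof.
move=> w0 [A0 Alin] Dlin.
(* Finiteness of the supremum becomes a pointwise bound with a real constant, which adds and scales
   easily. If the supremum is [-oo], the constant 0 serves. *)
have boundP f :
    (ereal_sup [set (modulus (D f p) / w (deg p))%:E | p in S] < +oo)%E <->
    exists C : R, forall p, S p -> modulus (D f p) <= C * w (deg p).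
  split=> [|[C fC]].
    have finP (N : \bar R) : (N < +oo)%E -> exists C : R, (N <= C%:E)%E.
      by case: N => [r _||_]//; [exists r|exists 0]; [exact: lexx|exact: leNye].
    move=> /finP[C NC]; exists C => p Sp; rewrite -ler_pdivrMr// -lee_fin.
    apply: le_trans NC.
    by apply: ereal_sup_ubound; exists p.
  apply: le_lt_trans (ltry C); apply: ge_ereal_sup => _ [p Sp <-].
  by rewrite lee_fin ler_pdivrMr// fC.
(* The linearity assumption at [a = -1], [f = g = 0] reads [D 0 p = - D 0 p + D 0 p]. *)
have D0 p : S p -> D 0 p = 0.
  move=> Sp; have := Dlin (-1) 0 0 p A0 A0 Sp.
  by rewrite scaler0 addr0 mulN1r addNr.
split=> [|a f g [Af /boundP[C fC]] [Ag /boundP[C' gC]]].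
  split=> //; apply/boundP; exists 0 => p Sp.
  by rewrite D0// mul0r /modulus normr0.
split; [exact: Alin|apply/boundP; exists (modulus a * C + C') => p Sp].
rewrite Dlin// mulrDl -mulrA; apply: le_trans (ler_normD (_ : Rcomplex R) _) _.
apply: lerD (gC _ Sp); rewrite -[leLHS]/(modulus (a * D f p)) modulusM.
by rewrite ler_wpM2l ?modulus_ge0// fC.
Qed.

End steps.

(** * The two systems of weights, for steps monotone in the weight up to a constant *)

Section limits_of_steps.
Context {R : realType} {V : lmodType R[i]} {M Phi : nat -> R}.
Variables (M_gt0 : forall j, 0 < M j) (Phi_exp : exponent_sequence Phi).
Variable B : (nat -> R) -> subtop V.
Hypothesis Bmono : forall (w w' : nat -> R) (C : R), 0 < C ->
  (forall j, 0 < w j) -> (forall j, 0 < w' j) ->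
  (forall j, w j <= C * w' j) -> cont_map id (B w) (B w').
Let MM := exponent_matrix M_gt0 Phi_exp.

Lemma cont_map_seq_mat (h : {posnum R}) :
  cont_map id (B (fun j => h%:num `^ Phi j * M j))
              (B (fun j => 1 ^+ j * MM h j)) /\
  cont_map id (B (fun j => 1 ^+ j * MM h j))
              (B (fun j => h%:num `^ Phi j * M j)).
Proof.
by split; apply: (@Bmono _ _ 1) => // j;
  rewrite ?mul1r ?expr1n ?mul1r ?mulr_gt0 ?powR_gt0.
Qed.

Lemma cont_map_mat_seq (x h : {posnum R}) : exists h' : {posnum R},
  cont_map id (B (fun j => h%:num ^+ j * MM x j))
              (B (fun j => h'%:num `^ Phi j * M j)).
Proof.
have [l [C lC]] := expr_le_powR_exponent Phi_exp (gt0 h).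
(* From [h ^+ j <= C * l]^ Phi j[, multiplication by]x [^ Phi j] merges both parameters into
   [l * x]. *)
exists (l%:num * x%:num)%:pos; apply: (@Bmono _ _ C%:num) => // j.
- by rewrite !mulr_gt0 ?exprn_gt0 ?powR_gt0.
- by rewrite !mulr_gt0 ?powR_gt0.
- by rewrite /= powRM// !mulrA ler_pM2r// ler_pM2r ?powR_gt0.
Qed.

Lemma cont_map_seq_mat_small (x h : {posnum R}) : exists h' : {posnum R},
  cont_map id (B (fun j => h'%:num `^ Phi j * M j))
              (B (fun j => h%:num ^+ j * MM x j)).
Proof.
have [l [C lC]] := powR_exponent_le_expr Phi_exp (gt0 h).
exists (l%:num * x%:num)%:pos; apply: (@Bmono _ _ C%:num) => // j.
- by rewrite !mulr_gt0 ?powR_gt0.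
- by rewrite !mulr_gt0 ?exprn_gt0 ?powR_gt0.
- by rewrite /= powRM// !mulrA ler_pM2r// ler_pM2r ?powR_gt0.
Qed.

Lemma roumieu_seq_mat : roumieu_seq M Phi B = roumieu_mat MM B.
Proof.
apply: indlim_cofinal => [h|[x h]]; last exact: cont_map_mat_seq.
by exists (h, 1%:pos); have [] := cont_map_seq_mat h.
Qed.

Lemma beurling_seq_mat : beurling_seq M Phi B = beurling_mat MM B.
Proof.
apply: interlim_cofinal => [h|[x h]]; last exact: cont_map_seq_mat_small.
by exists (h, 1%:pos); have [] := cont_map_seq_mat h.
Qed.

Lemma beurling_seq_mat_local : beurling_seq M Phi B = beurling_mat_local MM B.
Proof. by rewrite beurling_seq_mat /beurling_mat_local interlim_interlim. Qed.

(** The successive limits merge once each inner limit is linear. For fixed [x] the steps increase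
    with [h], so the inner limit is a directed union of linear spaces. *)
Lemma roumieu_seq_mat_local :
  (forall w, is_topology (points (B w)) (opens (B w))) ->
  (forall w, (forall j, 0 < w j) -> linear_subspace (points (B w))) ->
  roumieu_seq M Phi B = roumieu_mat_local MM B.
Proof.
move=> topB linB; rewrite roumieu_seq_mat /roumieu_mat_local.
rewrite indlim_indlim// => x.
have w0 (h : {posnum R}) j : 0 < h%:num ^+ j * MM x j.
  by rewrite !mulr_gt0 ?exprn_gt0 ?powR_gt0.
have wle (h h' : {posnum R}) : h%:num <= h'%:num ->
    points (B (fun j => h%:num ^+ j * MM x j)) `<=`
    points (B (fun j => h'%:num ^+ j * MM x j)).
  move=> hh'; suff [+ _] : cont_map id (B (fun j => h%:num ^+ j * MM x j))
    (B (fun j => h'%:num ^+ j * MM x j)) by [].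
  apply: (@Bmono _ _ 1) => // j; rewrite mul1r ler_pM2r ?mulr_gt0 ?powR_gt0//.
  by apply: lerXn2r; rewrite ?nnegrE.
split=> [|a f g [h _ hf] [h' _ hg]].
  by exists 1%:pos => //; have [] := linB _ (w0 1%:pos).
(* The step of parameter [h + h'] contains both given vectors. *)
have k0 : 0 < h%:num + h'%:num by [].
exists (PosNum k0) => //; have [_ +] := linB _ (w0 (PosNum k0)); apply.
  by apply: wle hf; rewrite /= lerDl.
by apply: wle hg; rewrite /= lerDr.
Qed.

End limits_of_steps.

(** * Real directional derivatives of complex linear combinations *)

Section complex_scaling.
Context {R : realType}.
Implicit Types (a : R[i]) (z : Rcomplex R).

(* For the library [Rcomplex R] is only a real vector space, so [*:] by a
   complex scalar is not available there. *)
Definition rcmul a (z : Rcomplex R) : Rcomplex R := (a : Rcomplex R) * z.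

Lemma normr_rcmul a z : `|rcmul a z| = modulus a * `|z|.
Proof. exact: modulusM. Qed.

Lemma rcmulB a : {morph rcmul a : z z' / z - z'}.
Proof. by move=> z z'; exact: mulrBr. Qed.

Lemma rcmulZ a (k : R) z : rcmul a (k *: z) = k *: rcmul a z.
Proof. by rewrite /rcmul mulrC -scalerAl mulrC. Qed.

Lemma rcmul_continuous a : continuous (rcmul a).
Proof.
move=> z; apply/(@cvgrPdist_lt R (Rcomplex R) _ _ (nbhs_filter z)) => e e0.
(* Adding 1 keeps the Lipschitz constant invertible when [a = 0]. *)
pose c : R := modulus a + 1.
have c0 : 0 < c by rewrite ltr_wpDl ?modulus_ge0.
near=> y.
rewrite -rcmulB normr_rcmul.
apply: (@le_lt_trans _ _ (c * `|z - y|)).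
  by rewrite ler_wpM2r// lerDl.
rewrite -ltr_pdivlMl//; near: y.
apply/nbhs_normP; exists (c^-1 * e) => //=.
by rewrite mulr_gt0// invr_gt0.
Unshelve. all: by end_near. Qed.

Lemma cvg_rcmulD {T : Type} {F : set_system T} {FF : Filter F} a
    {f g : T -> Rcomplex R} {z z' : Rcomplex R} :
  f @ F --> z -> g @ F --> z' ->
  (fun x => rcmul a (f x) + g x) @ F --> rcmul a z + z'.
Proof.
move=> fz gz; apply: (cvgD _ gz).
exact: (cvg_comp _ _ fz (@rcmul_continuous a z)).
Qed.

(** The real factor [h^-1] commutes with multiplication by [a], so the difference quotient of the
    combination is the combination of the difference quotients. *)
Lemma is_derive_rcmulD {U : normedModType R} (f g : U -> Rcomplex R)
    (x v : U) a :
  derivable f x v -> derivable g x v ->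
  is_derive x v (fun y => rcmul a (f y) + g y) (rcmul a ('D_v f x) + 'D_v g x).
Proof.
move=> df dg.
have quot : (fun h : R => h^-1 *:
      (((fun y => rcmul a (f y) + g y) \o shift x) (h *: v)
       - (rcmul a (f x) + g x))) =
   (fun h => rcmul a (h^-1 *: ((f \o shift x) (h *: v) - f x)) +
             h^-1 *: ((g \o shift x) (h *: v) - g x)).
  apply/funext => h /=.
  by rewrite opprD addrACA scalerDr -rcmulB rcmulZ.
have lim_fg : h^-1 *: (((fun y => rcmul a (f y) + g y) \o shift x) (h *: v)
      - (rcmul a (f x) + g x)) @[h --> 0^'] --> rcmul a ('D_v f x) + 'D_v g x.
  by rewrite quot; apply: cvg_rcmulD; [exact: df|exact: dg].
apply: DeriveDef; first by apply/cvg_ex; eexists; exact: lim_fg.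
exact: cvg_lim lim_fg.
Qed.

End complex_scaling.

(** * Linearity of smooth functions and of their derivatives up to the boundary *)

Section smooth_linear.
Context {R : realType} {d : nat}.
Local Notation fct := ('rV[R]_d -> R[i]).
Implicit Types (U K : set 'rV[R]_d) (f g : fct) (x : 'rV[R]_d).

(** Induction on [s]: the identity for a shorter list holds on all of the open set [U], hence near
    [x], and may be differentiated there. *)
Lemma partials_linear {U} {a : R[i]} {f g s x} :
  open U -> smooth U f -> smooth U g -> U x ->
  @partials R d (Rcomplex R) s (a *: f + g) x =
  rcmul a (@partials R d (Rcomplex R) s f x) + @partials R d (Rcomplex R) s g x.
Proof.
move=> Uo fU gU; elim: s x => [//|i s IH] x Ux /=.
rewrite /partial -[RHS](@derive_val _ _ _ _ _ _ _
                          (is_derive_rcmulD _ _ _ _ a _ _)).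
- apply: near_eq_derive; near=> y; apply: IH.
  by near: y; apply: open_nbhs_nbhs; split.
- exact: (fU s x Ux).2.
- exact: (gU s x Ux).2.
Unshelve. all: by end_near. Qed.

Lemma smooth_linear {U} {a : R[i]} {f g} : open U -> smooth U f -> smooth U g ->
  smooth U (a *: f + g).
Proof.
move=> Uo fU gU s x Ux.
have near_linear : \forall y \near x,
    rcmul a (@partials R d (Rcomplex R) s f y) +
      @partials R d (Rcomplex R) s g y =
    @partials R d (Rcomplex R) s (a *: f + g) y.
  near=> y; rewrite (partials_linear (U := U))//.
  by near: y; apply: open_nbhs_nbhs; split.
split=> [|i].
  rewrite /prop_for /continuous_at (partials_linear Uo)//.
  apply: cvg_trans (near_eq_cvg near_linear) _.
  by apply: cvg_rcmulD; [exact: (fU s x Ux).1|exact: (gU s x Ux).1].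
apply: (near_eq_derivable near_linear).
apply: ex_derive; apply: is_derive_rcmulD.
  exact: (fU s x Ux).2.
exact: (gU s x Ux).2.
Unshelve. all: by end_near. Qed.

(** Reduces multi-index derivatives to lists of directions, the form in which [smooth_on] and the
    inductions are stated. *)
Lemma mpartialE {W : normedModType R} (al : {ffun 'I_d -> nat}) :
  @mpartial R d W al = partials (flatten [seq nseq (al i) i | i <- enum 'I_d]).
Proof.
apply/funext => f; rewrite /mpartial /partials.
elim: (enum 'I_d) => //= i s ->; rewrite foldr_cat.
by elim: (al i) => //= n ->.
Qed.

Lemma mderiv_linear {U} {a : R[i]} {f g al x} :
  open U -> smooth U f -> smooth U g -> U x ->
  mderiv al (a *: f + g) x = a * mderiv al f x + mderiv al g x.
Proof.
move=> Uo fU gU Ux; rewrite /mderiv mpartialE.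
exact: partials_linear Uo fU gU Ux.
Qed.

Lemma partials0 s : @partials R d (Rcomplex R) s (0 : fct) = cst 0.
Proof.
elim: s => //= i s ->; apply/funext => x.
by rewrite /partial derive_cst.
Qed.

Lemma smooth0 U : smooth U (0 : fct).
Proof.
move=> s x Ux; rewrite partials0; split=> [|i]; first exact: cst_continuous.
exact: derivable_cst.
Qed.

(** Derivatives on [K] are limits from the interior. Every point of [K] is adherent to the interior,
    so these limits are unique and inherit linearity from the derivatives inside. *)
Lemma smooth_functions_on_linear {K} : closure K° = K ->
  linear_subspace (smooth_functions_on K) /\
  forall (a : R[i]) f g al x,
    smooth_functions_on K f -> smooth_functions_on K g -> K x ->
    mderiv_on K al (a *: f + g) x = a * mderiv_on K al f x + mderiv_on K al g x.
Proof.
move=> clK.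
(* This convergence gives both the existence of the extended derivative of the combination and its
   value. *)
have cvg_mderiv (a : R[i]) f g al x :
    smooth_functions_on K f -> smooth_functions_on K g -> K x ->
    (mderiv al (a *: f + g) : _ -> Rcomplex R) @ within K° (nbhs x) -->
    rcmul a (mderiv_on K al f x) + (mderiv_on K al g x : Rcomplex R).
  move=> [fK fcvg _ _] [gK gcvg _ _] Kx.
  apply: (cvg_trans _ (cvg_rcmulD a (fcvg al x Kx) (gcvg al x Kx))).
  apply: near_eq_cvg; near=> y.
  rewrite (mderiv_linear (U := K°))//; first exact: open_interior.
  by near: y; exact: withinT.
split; last first.
  move=> a f g al x fK gK Kx.
  have PF : ProperFilter (within K° (nbhs x)).
    by apply: within_nbhs_proper; rewrite /infer clK.
  exact: (cvg_lim (@norm_hausdorff _ (Rcomplex R))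
                  (cvg_mderiv a f g al x fK gK Kx)).
split=> [|a f g fK gK].
  have mderiv0 al : mderiv al (0 : fct) = cst 0.
    rewrite /mderiv mpartialE; exact: partials0.
  split=> // [|al x Kx|x Kx]; first exact: smooth0.
  - by rewrite mderiv0; apply: is_cvg_cst.
  - exact: cvg_cst.
have [fs fcvg f0 f1] := fK; have [gs gcvg g0 g1] := gK.
split=> [|al x Kx|x Kx|x nKx].
- by apply: smooth_linear => //; exact: open_interior.
- by apply/cvg_ex; eexists; exact: cvg_mderiv.
- exact: (cvg_rcmulD a (f0 x Kx) (g0 x Kx)).
- by rewrite -[LHS]/(a * f x + g x) f1// g1// mulr0 addr0.
Unshelve. all: by end_near. Qed.

End smooth_linear.

(** * Equality of the classes *)

Theorem theorem4p4 (R : realType) (M Phi : nat -> R)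
    (M_gt0 : forall j, 0 < M j) (Phi_exp : exponent_sequence Phi) :
  let MM := exponent_matrix M_gt0 Phi_exp in
  [/\ forall (d : nat) (U : set 'rV[R]_d), (1 <= d)%N -> open U -> U !=set0 ->
        E_class U (roumieu_seq M Phi) = E_class U (roumieu_mat_local MM) /\
        E_class U (beurling_seq M Phi) = E_class U (beurling_mat_local MM),
      forall (d : nat) (U : set 'rV[R]_d), (1 <= d)%N -> open U -> U !=set0 ->
        B_class U (roumieu_seq M Phi) = B_class U (roumieu_mat MM) /\
        B_class U (beurling_seq M Phi) = B_class U (beurling_mat MM),
      forall (d : nat) (U : set 'rV[R]_d), (1 <= d)%N -> open U -> U !=set0 ->
        D_class U (roumieu_seq M Phi) = D_class U (roumieu_mat MM) /\
        D_class U (beurling_seq M Phi) = D_class U (beurling_mat MM),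
      forall (tau gamma : R) (r : \bar R), 0 < gamma -> (0 < r)%E ->
        A_class (sector tau gamma r) (roumieu_seq M Phi) =
        A_class (sector tau gamma r) (roumieu_mat MM) /\
        A_class (sector tau gamma r) (beurling_seq M Phi) =
        A_class (sector tau gamma r) (beurling_mat MM) &
      forall d : nat, (1 <= d)%N ->
        Lambda_class (d := d) (roumieu_seq M Phi) =
        Lambda_class (d := d) (roumieu_mat MM) /\
        Lambda_class (d := d) (beurling_seq M Phi) =
        Lambda_class (d := d) (beurling_mat MM)].
Proof.
move=> MM.
(* Covers at once the four kinds of classes whose limits over [x] and [h] are simultaneous. *)
have seq_mat (V : lmodType R[i]) P (A : set V) S D deg :
    roumieu_seq M Phi (@weighted_space R V P A S D deg) =
    roumieu_mat MM (weighted_space A S D deg) /\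
    beurling_seq M Phi (weighted_space A S D deg) =
    beurling_mat MM (weighted_space A S D deg).
  split; [apply: roumieu_seq_mat|apply: beurling_seq_mat] => w w' C;
    exact: cont_map_weighted_space.
split=> [d U _ _ _|d U _ _ _|d U _ _ _|tau gamma r _ _|d _].
- have E_stepE (K : set 'rV[R]_d) : E_step K =
      weighted_space (smooth_functions_on K) [set p | K p.2]
      (fun f p => mderiv_on K p.1 f p.2) (fun p => mdegree p.1).
    by [].
  (* Both sides carry the same outer limit over [K], so the spaces are compared for each [K]; its
     regularity provides [clK], from which linearity of the steps follows. *)
  split; congr projlim; apply/funext => -[K [[_ clK _] _]] /=; rewrite E_stepE.
    apply: roumieu_seq_mat_local => [w w' C|w|w w0].
    + exact: cont_map_weighted_space.
    + exact: normed_space_topology.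
    + have [subK linK] := smooth_functions_on_linear clK.
      by apply: weighted_space_subspace => // a f g p fK gK Kp; exact: linK.
  apply: beurling_seq_mat_local => w w' C; exact: cont_map_weighted_space.
- exact: (seq_mat _ _ _ [set p | U p.2] (fun f p => mderiv p.1 f p.2)
    (fun p => mdegree p.1)).
- split; congr indlim; apply/funext => -[K _] /=.
    exact: (seq_mat _ _ _ setT (fun f p => mderiv p.1 f p.2)
      (fun p => mdegree p.1)).1.
  exact: (seq_mat _ _ _ setT (fun f p => mderiv p.1 f p.2)
    (fun p => mdegree p.1)).2.
- exact: (seq_mat _ _ _ [set p | sector tau gamma r p.2]
    (fun f p => iter p.1 (@cderiv R) f p.2) fst).
- exact: (seq_mat _ _ setT setT (fun c a => c a) (@mdegree d)).
Qed.
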